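(* The variety $\mathbf{SI}$ of strict $I$-semigroups, and all its subvarieties, are locally $\mathcal{H}$-finite.
   Context: An $I$-semigroup is an algebra with a binary operation and a unary operation $x\mapsto x'$ satisfying $x(yz)=(xy)z$, $(x')'=x$, $xx'x=x$. $\mathbf{SI}$ is the variety of strict $I$-semigroups, namely the $I$-semigroups satisfying the identities $$xx'x'x=x'xxx',\quad (xyx')(xyx')'=(xyx')'(xyx'),\quad x(yz)'w=xz'y'w,\quad (xy)'=(x'xy)'(xyy')'.$$ On a semigroup $S$: $a\,\mathcal{L}\,b \iff S^1a=S^1b$; $a\,\mathcal{R}\,b\iff aS^1=bS^1$; $\mathcal{H}=\mathcal{L}\cap\mathcal{R}$. A semigroup is $\mathcal{H}$-finite if it has only finitely many distinct $\mathcal{H}$-classes (for an $I$-semigroup, Green's relations are those of the underlying semigroup). A variety $\mathbf{V}$ is locally $\mathcal{H}$-finite if each finitely generated member of $\mathbf{V}$ (finitely generated as an algebra of type $(2,1)$) is $\mathcal{H}$-finite. *)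

(* Defs.v *)
From mathcomp Require Import all_boot.
From mathcomp Require Import boolp classical_sets functions cardinality.

Set Implicit Arguments.
Unset Strict Implicit.
Unset Printing Implicit Defensive.

Local Open Scope classical_set_scope.

(* S^1 a and a S^1: the adjoined identity contributes the element a itself. *)
Definition left_ideal1 (S : Type) (op : S -> S -> S) (a : S) : set S :=
  [set a] `|` [set op s a | s in setT].
Definition right_ideal1 (S : Type) (op : S -> S -> S) (a : S) : set S :=
  [set a] `|` [set op a s | s in setT].

Definition greenL (S : Type) (op : S -> S -> S) (a b : S) : Prop :=
  left_ideal1 op a = left_ideal1 op b.
Definition greenR (S : Type) (op : S -> S -> S) (a b : S) : Prop :=
  right_ideal1 op a = right_ideal1 op b.
Definition greenH (S : Type) (op : S -> S -> S) (a b : S) : Prop :=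
  greenL op a b /\ greenR op a b.

Definition greenH_class (S : Type) (op : S -> S -> S) (a : S) : set S :=
  [set b | greenH op a b].

Definition H_finite (S : Type) (op : S -> S -> S) : Prop :=
  finite_set [set greenH_class op a | a in setT].

Record algebra := Algebra {
  carrier :> Type;
  mul : carrier -> carrier -> carrier;
  inv : carrier -> carrier
}.

Definition subalgebra (A : algebra) (B : set A) : Prop :=
  (forall a b, B a -> B b -> B (mul a b)) /\ (forall a, B a -> B (inv a)).

Definition finitely_generated (A : algebra) : Prop :=
  exists G : set A, finite_set G /\ smallest (@subalgebra A) G = setT.

Inductive term := Var of nat | Mul of term & term | Inv of term.

Fixpoint eval (A : algebra) (v : nat -> A) (t : term) : A :=
  match t with
  | Var i => v i
  | Mul s t => mul (eval v s) (eval v t)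
  | Inv t => inv (eval v t)
  end.

Definition identity := (term * term)%type.

Definition satisfies (A : algebra) (e : identity) : Prop :=
  forall v : nat -> A, eval v e.1 = eval v e.2.

Definition models (E : set identity) : set algebra :=
  [set A | forall e, E e -> satisfies A e].

Definition variety (V : set algebra) : Prop :=
  exists E : set identity, V = models E.

Definition locally_H_finite (V : set algebra) : Prop :=
  forall A : algebra, V A -> finitely_generated A -> H_finite (@mul A).

Declare Scope term_scope.
Delimit Scope term_scope with term.
Bind Scope term_scope with term.
Notation "s * t" := (Mul s t) : term_scope.
Notation "t ^'" := (Inv t) : term_scope.
Notation "s ≈ t" := ((s%term, t%term) : identity)
  (at level 70, no associativity) : classical_set_scope.

Local Notation x := (Var 0).
Local Notation y := (Var 1).
Local Notation z := (Var 2).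
Local Notation w := (Var 3).

Definition I_semigroup_identities : set identity :=
  [set x * (y * z) ≈ x * y * z;
       x^'^' ≈ x;
       x * x^' * x ≈ x].

Definition strict_identities : set identity :=
  [set x * x^' * x^' * x ≈ x^' * x * x * x^';
       (x * y * x^') * (x * y * x^')^' ≈ (x * y * x^')^' * (x * y * x^');
       x * (y * z)^' * w ≈ x * z^' * y^' * w;
       (x * y)^' ≈ (x^' * x * y)^' * (x * y * y^')^'].

Definition SI : set algebra :=
  models (I_semigroup_identities `|` strict_identities).

Lemma SI_variety : variety SI.
Proof. by exists (I_semigroup_identities `|` strict_identities). Qed.

Lemma SI_equations (A : algebra) (m := @mul A) (i := @inv A) :
  SI A <->
  [/\ (forall a b c, m a (m b c) = m (m a b) c),
      (forall a, i (i a) = a) &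
      (forall a, m (m a (i a)) a = a)] /\
  [/\ (forall a, m (m (m a (i a)) (i a)) a = m (m (m (i a) a) a) (i a)),
      (forall a b (e := m (m a b) (i a)), m e (i e) = m (i e) e),
      (forall a b c d, m (m a (i (m b c))) d = m (m (m a (i c)) (i b)) d) &
      (forall a b, i (m a b) = m (i (m (m (i a) a) b)) (i (m (m a b) (i b))))].
Proof.
split=> [AS|[[h1 h2 h3] [h4 h5 h6 h7]]]; last first.
  by move=> e [[[]|]|[[[]|]|]] -> u /=; [exact: h1 | exact: h2 | exact: h3
    | exact: h4 | exact: h5 | exact: h6 | exact: h7].
pose u (a b c d : A) := nth a [:: a; b; c; d].
split; split.
- by move=> a b c; apply: (AS _ (or_introl (or_introl (or_introl erefl))) (u a b c a)).
- by move=> a; apply: (AS _ (or_introl (or_introl (or_intror erefl))) (u a a a a)).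
- by move=> a; apply: (AS _ (or_introl (or_intror erefl)) (u a a a a)).
- by move=> a; apply: (AS _ (or_intror (or_introl (or_introl (or_introl erefl)))) (u a a a a)).
- by move=> a b; apply: (AS _ (or_intror (or_introl (or_introl (or_intror erefl)))) (u a b a a)).
- by move=> a b c d; apply: (AS _ (or_intror (or_introl (or_intror erefl))) (u a b c d)).
- by move=> a b; apply: (AS _ (or_intror (or_intror erefl)) (u a b a a)).
Qed.

(* Main.v *)
Require Import Defs.
From mathcomp Require Import all_boot.
From mathcomp Require Import boolp classical_sets functions cardinality.

(** Why finitely generated strict I-semigroups have finitely many H-classes.  The
    inverse of [a] is written [a'] in the explanations.

    Up to their maximal subgroups, the building blocks of a strict I-semigroup are
    products of a Brandt semigroup with a rectangular band, with a zero
    adjoined.  In such a block a product of generators vanishes exactly when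
    some two consecutive factors do not match; otherwise its R-class is that
    of its first factor.  Hence the R-class of a product of generators and
    their inverses depends only on its first letter and on the set of its
    pairs of consecutive letters, and there are finitely many such data.
    The equational form of this is [rle_strict]: an element of [p a S] that
    also factors as [q a b r] lies in [p a b S].  It is iterated along a word
    in [rle_code].  The axioms are left-right symmetric, so words also meet
    finitely many L-classes, hence finitely many H-classes.

    Not every element is a word, since the inverse of a product need not be the
    product of the inverses in reverse order.  It is so inside a product,
    however, so that every element can be replaced by a word as long as it has
    a factor on its left and one on its right ([inner_word]), and replacing a
    last factor does not change the R-class ([rle_inner]).  What remains is to
    control first factors: each element is a right multiple of a letter or of
    some [(d x)'] with [d] a letter ([rle_letter_or_inv]).  In the latter
    case [(d x)'] is R-related to the inverse of a word ([rle_inv_inner]),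
    and the R-class of the inverse of a word depends only on the H-class of
    the word ([rle_inv_H]).  Hence every R-class contains a word or an
    element [k' w] with [w] a word and [k] one of finitely many words; and
    [k' w = k' (k k' w)] where the factor in parentheses is equal to a
    word starting with [k].  So there are finitely many R-classes, dually
    finitely many L-classes, and an H-class is the intersection of an R-class
    and an L-class. *)

Local Open Scope classical_set_scope.

Set Implicit Arguments.
Unset Strict Implicit.
Unset Printing Implicit Defensive.

Local Notation "a ⋅ b" := (Defs.mul a b) (at level 40, left associativity).
Local Notation "a ^-1" := (Defs.inv a).

(** * Strict I-semigroups *)

Section StrictISemigroup.

Variables (A : algebra) (SA : SI A).
Implicit Types a b c d e f p q r s t u v x y z : A.

Lemma mulA a b c : a ⋅ (b ⋅ c) = a ⋅ b ⋅ c.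
Proof. by have [[h _ _] _] := (SI_equations A).1 SA; exact: h. Qed.

Lemma invK a : a^-1^-1 = a.
Proof. by have [[_ h _] _] := (SI_equations A).1 SA; exact: h. Qed.

Lemma mulVK a : a ⋅ a^-1 ⋅ a = a.
Proof. by have [[_ _ h] _] := (SI_equations A).1 SA; exact: h. Qed.

Lemma mul_inv_comm a : a ⋅ a^-1 ⋅ a^-1 ⋅ a = a^-1 ⋅ a ⋅ a ⋅ a^-1.
Proof. by have [_ [h _ _ _]] := (SI_equations A).1 SA; exact: h. Qed.

Lemma conj_comm a b (c := a ⋅ b ⋅ a^-1) : c ⋅ c^-1 = c^-1 ⋅ c.
Proof. by have [_ [_ h _ _]] := (SI_equations A).1 SA; exact: h. Qed.

Lemma inv_mul_inner a b c d : a ⋅ (b ⋅ c)^-1 ⋅ d = a ⋅ c^-1 ⋅ b^-1 ⋅ d.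
Proof. by have [_ [_ _ h _]] := (SI_equations A).1 SA; exact: h. Qed.

Lemma inv_mul a b : (a ⋅ b)^-1 = (a^-1 ⋅ a ⋅ b)^-1 ⋅ (a ⋅ b ⋅ b^-1)^-1.
Proof. by have [_ [_ _ _ h]] := (SI_equations A).1 SA; exact: h. Qed.

Lemma mulVKr x a : x ⋅ a ⋅ a^-1 ⋅ a = x ⋅ a.
Proof. by rewrite -!mulA [a ⋅ _]mulA mulVK. Qed.

Lemma mulKV a : a^-1 ⋅ a ⋅ a^-1 = a^-1.
Proof. by rewrite -{2}[a]invK mulVK. Qed.

(** The third strict identity with all variables equal to [e] gives
    [e = e e' e' e], and the first one turns the right-hand side into
    [e' e e e' = e']. *)
Lemma idem_inv e : e ⋅ e = e -> e^-1 = e.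
Proof.
move=> ee; have := inv_mul_inner e e e e.
by rewrite ee mulVK mul_inv_comm -(mulA _ e e) ee mulKV.
Qed.

(** Idempotents form a band: between [f] and [e], the inverse of [e f] is
    [f e], which turns [e f (e f)' e f = e f] into idempotency. *)
Lemma idem_mul e f : e ⋅ e = e -> f ⋅ f = f -> e ⋅ f ⋅ (e ⋅ f) = e ⋅ f.
Proof.
move=> ee ff; rewrite -{3}(mulVK (e ⋅ f)).
have h : f ⋅ (e ⋅ f)^-1 ⋅ e = f ⋅ e.
  by rewrite inv_mul_inner !idem_inv// ff -mulA ee.
rewrite -!mulA; congr (_ ⋅ _); rewrite !mulA; congr (_ ⋅ _).
by rewrite h.
Qed.

Lemma idem_mulV a : a ⋅ a^-1 ⋅ (a ⋅ a^-1) = a ⋅ a^-1.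
Proof. by rewrite mulA mulVK. Qed.

Lemma idem_Vmul a : a^-1 ⋅ a ⋅ (a^-1 ⋅ a) = a^-1 ⋅ a.
Proof. by rewrite mulA mulKV. Qed.

(** Green's preorder of R; [S] replaces the ideal [S^1] because [b = b b' b]. *)
Definition rle a b := exists x, a = b ⋅ x.

Lemma rle_mulr a x : rle (a ⋅ x) a.
Proof. by exists x. Qed.

Lemma rle_refl a : rle a a.
Proof. by exists (a^-1 ⋅ a); rewrite mulA mulVK. Qed.

Lemma rle_trans b a c : rle a b -> rle b c -> rle a c.
Proof. by move=> [x ->] [y ->]; rewrite -mulA; exact: rle_mulr. Qed.

Lemma rle_mull c a b : rle a b -> rle (c ⋅ a) (c ⋅ b).
Proof. by move=> [x ->]; rewrite mulA; exact: rle_mulr. Qed.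

Lemma rle_id a b : rle a b -> b ⋅ b^-1 ⋅ a = a.
Proof. by move=> [x ->]; rewrite mulA mulVK. Qed.

Lemma rle_right_ideal a b :
  rle a b -> rle b a -> right_ideal1 (@Defs.mul A) a = right_ideal1 (@Defs.mul A) b.
Proof.
have sub c d : rle c d -> right_ideal1 (@Defs.mul A) c `<=` right_ideal1 (@Defs.mul A) d.
  move=> [x ->] _ [->|[y _ <-]]; first by right; exists x.
  by right; exists (x ⋅ y) => //; rewrite mulA.
by move=> ab ba; apply/seteqP; split; exact: sub.
Qed.

Lemma right_ideal_rle a b :
  right_ideal1 (@Defs.mul A) a = right_ideal1 (@Defs.mul A) b -> rle a b.
Proof.
move=> ab; have : right_ideal1 (@Defs.mul A) b a by rewrite -ab; left.
by move=> [->|[x _ <-]]; [exact: rle_refl | exact: rle_mulr].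
Qed.

Lemma left_ideal_mul a b :
  left_ideal1 (@Defs.mul A) a = left_ideal1 (@Defs.mul A) b ->
  exists z, a = z ⋅ b.
Proof.
move=> ab; have : left_ideal1 (@Defs.mul A) b a by rewrite -ab; left.
by move=> [->|[z _ <-]]; [exists (b ⋅ b^-1); rewrite mulVK | exists z].
Qed.

(** The local structure of strictness.  Put [t = a' p' q a]; the hypothesis
    gives [p a x = p a t b r].  Before the factor [b], [t] may be replaced by
    [u = t g], where [g = a'a bb' a'a] is idempotent.  As [u] is of the form
    [c y c'], the second strict identity makes it commute with [u'], so
    [u = a'a u = a'a u' u u]; between two factors [u' = (t g)'] is [g t'], so
    [u] starts with [g].  Finally [p a g] starts with [p a b]. *)
Lemma rle_strict p a x q b r :
  p ⋅ a ⋅ x = q ⋅ a ⋅ b ⋅ r -> rle (p ⋅ a ⋅ x) (p ⋅ a ⋅ b).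
Proof.
move=> E; pose t := a^-1 ⋅ (p^-1 ⋅ q) ⋅ a.
have tE : p ⋅ a ⋅ x = p ⋅ a ⋅ t ⋅ b ⋅ r.
  rewrite -{1}(rle_id (rle_mulr (p ⋅ a) x)) E.
  have := inv_mul_inner (p ⋅ a) p a (q ⋅ a ⋅ b ⋅ r).
  by rewrite /t !mulA => ->.
have [f fE] : exists f, f = a^-1 ⋅ a by eexists.
have [h hE] : exists h, h = b ⋅ b^-1 by eexists.
have ff : f ⋅ f = f by rewrite fE idem_Vmul.
have hh : h ⋅ h = h by rewrite hE idem_mulV.
have hb : h ⋅ b = b by rewrite hE mulVK.
have tf : t ⋅ f = t by rewrite /t fE !mulA mulVKr.
pose g := f ⋅ h ⋅ f.
have fg : f ⋅ g = g by rewrite /g !mulA ff.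
have gb : g ⋅ b = f ⋅ b by rewrite -{1}hb /g mulA -(mulA _ f) idem_mul// -mulA hb.
have tb : t ⋅ b = t ⋅ g ⋅ b by rewrite -mulA gb mulA tf.
pose u := t ⋅ g.
have uu : u ⋅ u^-1 = u^-1 ⋅ u.
  have -> : u = a^-1 ⋅ (p^-1 ⋅ q ⋅ a ⋅ f ⋅ h ⋅ a^-1) ⋅ a^-1^-1.
    by rewrite /u /t /g invK {2}fE !mulA.
  exact: (conj_comm a^-1).
have fu : f ⋅ u = u by rewrite /u /t fE !mulA mulKV.
have uE : u = g ⋅ (t^-1 ⋅ u ⋅ u).
  have gV : g^-1 = g by apply: idem_inv; do 2 apply: idem_mul => //.
  have fuV : f ⋅ u^-1 ⋅ u = g ⋅ t^-1 ⋅ u by rewrite /u inv_mul_inner gV fg.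
  have uuu : u = u^-1 ⋅ u ⋅ u by rewrite -uu mulVK.
  rewrite [RHS](_ : _ = f ⋅ (u^-1 ⋅ u ⋅ u)); first by rewrite -uuu fu.
  by rewrite (mulA g) (mulA g) -fuV (mulA f) (mulA f).
rewrite tE -(mulA _ t) tb -/u uE.
exists (b^-1 ⋅ f ⋅ (t^-1 ⋅ u ⋅ u) ⋅ b ⋅ r).
by rewrite /g hE fE !mulA mulVKr.
Qed.

(** Write [v = u t].  The fourth strict identity shows that [v'] is a right
    multiple of [(u' u t)' = t'], and [t' = t t' t'] starts with [t], hence
    with [u']. *)
Lemma rle_inv u v (t := u^-1 ⋅ v) :
  rle v u -> t ⋅ t^-1 = t^-1 ⋅ t -> rle v^-1 u^-1.
Proof.
move=> /rle_id vE tt.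
have -> : v^-1 = t^-1 ⋅ (u ⋅ t ⋅ t^-1)^-1.
  by rewrite -{1}vE -mulA inv_mul /t !mulA mulKV.
have -> : t^-1 = t ⋅ t^-1 ⋅ t^-1 by rewrite tt mulKV.
by rewrite /t -!mulA; exact: rle_mulr.
Qed.

(** If moreover [v = z u], then [u' v] is the conjugate [u' z u]. *)
Lemma rle_inv_H u v : rle v u -> (exists z, v = z ⋅ u) -> rle v^-1 u^-1.
Proof.
move=> vu [z vE]; apply: rle_inv => //.
have -> : u^-1 ⋅ v = u^-1 ⋅ z ⋅ u^-1^-1 by rewrite invK vE mulA.
exact: conj_comm.
Qed.

(** Equality as an inner factor.  By the third strict identity this is the
    relation modulo which inversion reverses products. *)
Definition inner_eq s t := forall x y, x ⋅ s ⋅ y = x ⋅ t ⋅ y.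

Lemma inner_eq_mul s s' t t' :
  inner_eq s s' -> inner_eq t t' -> inner_eq (s ⋅ t) (s' ⋅ t').
Proof. by move=> ss tt x y; rewrite !mulA tt -!mulA (mulA x) ss !mulA. Qed.

Lemma inner_eqr s t : inner_eq s t -> forall x, x ⋅ s = x ⋅ t ⋅ (s^-1 ⋅ s).
Proof. by move=> st x; rewrite -st !mulA mulVKr. Qed.

Lemma inner_eq_sym s t : inner_eq s t -> inner_eq t s.
Proof. by move=> st x y; rewrite st. Qed.

(** The factor [s' s] serves as right context: [x s = x s (s' s) = x t (s' s)]. *)
Lemma rle_inner s t x : inner_eq s t -> rle (x ⋅ s) (x ⋅ t).
Proof. by move=> /inner_eqr ->; exact: rle_mulr. Qed.

(** Here [(x t)' (x s)] is a product of two idempotents, so it is idempotent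
    and is its own inverse. *)
Lemma rle_inv_inner s t x : inner_eq s t -> rle (x ⋅ s)^-1 (x ⋅ t)^-1.
Proof.
move=> st; apply: rle_inv; first exact: rle_inner.
have -> : (x ⋅ t)^-1 ⋅ (x ⋅ s) = ((x ⋅ t)^-1 ⋅ (x ⋅ t)) ⋅ (s^-1 ⋅ s).
  by rewrite mulA (inner_eqr st) !mulA.
set e := _ ⋅ (s^-1 ⋅ s).
by rewrite idem_inv// idem_mul// idem_Vmul.
Qed.

End StrictISemigroup.

(** * Left-right duality *)

Definition opp (A : algebra) : algebra :=
  @Algebra A (fun a b => b ⋅ a) (@Defs.inv A).

(** Reversing products maps each axiom to itself, up to renaming variables
    and replacing one of them by its inverse in the second strict identity. *)
Lemma SI_opp (A : algebra) : SI A -> SI (opp A).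
Proof.
move=> SA; apply/SI_equations; split; split => /=.
- by move=> a b c; rewrite -[LHS](mulA SA).
- by move=> a; exact: invK.
- by move=> a; rewrite -[RHS](mulVK SA) -(mulA SA).
- by move=> a; rewrite !(mulA SA) (mul_inv_comm SA).
- move=> a b; have := conj_comm SA a^-1 b.
  by rewrite invK// -(mulA SA) => ->.
- by move=> a b c d; rewrite !(mulA SA) inv_mul_inner.
- by move=> a b; rewrite [LHS](inv_mul SA) -!(mulA SA).
Qed.

(** * Functions with finite range *)

Lemma finite_image_factor (T U : Type) (C : finType) (c : T -> C) (f : T -> U) :
  (forall s t, c s = c t -> f s = f t) -> finite_set (range f).
Proof.
move=> cf; pose fibres := \bigcup_(k in [set: C]) f @` (c @^-1` [set k]).
apply: (@sub_finite_set _ _ fibres).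
  by move=> _ [t _ <-]; exists (c t) => //; exists t.
apply: bigcup_finite => [|k _]; first exact: finite_finset.
have [[t tk]|no] := pselect (exists t, c t = k).
  apply: sub_finite_set (finite_set1 (f t)) => _ [s sk <-].
  by apply: cf; rewrite tk.
by apply: sub_finite_set (@finite_set0 U) => u [s sk _]; case: no; exists s.
Qed.

Lemma finite_representatives (T U : Type) (f : T -> U) :
  finite_set (range f) ->
  exists K : set T, finite_set K /\ forall t, exists2 k, K k & f k = f t.
Proof.
move=> fin.
have /choice[r rP] u : exists S : set T,
    finite_set S /\ forall t, f t = u -> exists2 k, S k & f k = u.
  have [[t tu]|no] := pselect (exists t, f t = u).
    by exists [set t]; split => // _ _; exists t.
  by exists set0; split => // t tu; case: no; exists t.
exists (\bigcup_(u in range f) r u); split.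
  by apply: bigcup_finite => // u _; have [] := rP u.
move=> t; have [_ /(_ t erefl)[k rk kt]] := rP (f t).
by exists k => //; exists (f t) => //; exists t.
Qed.

(** * Words *)

Section Words.

Variables (A : algebra) (SA : SI A) (L : finType) (l : L -> A).

Fixpoint wval (a : L) (s : seq L) : A :=
  if s is b :: r then l a ⋅ wval b r else l a.

Lemma wval_cat a s b r : wval a (s ++ b :: r) = wval a s ⋅ wval b r.
Proof. by elim: s a => //= c s IH a; rewrite IH mulA. Qed.

Lemma wval_rcons a s b : wval a (rcons s b) = wval a s ⋅ l b.
Proof. by rewrite -cats1 wval_cat. Qed.

Lemma wval_last a s : wval a s ⋅ (l (last a s))^-1 ⋅ l (last a s) = wval a s.
Proof.
elim: s a => [|b s IH] a /=; first by rewrite mulVK.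
by rewrite -{2}(IH b) !mulA.
Qed.

Lemma rle_wval_head a s : rle (wval a s) (l a).
Proof. by case: s => [|b s] /=; [exact: rle_refl|exact: rle_mulr]. Qed.

Lemma wval_infix a s b c : infix [:: b; c] (a :: s) ->
  exists q r, wval a s = q ⋅ l b ⋅ l c ⋅ r.
Proof.
have suf t : exists r, wval c t = l c ⋅ r by apply: rle_wval_head.
move=> /infixP[[|a' u] [v /= [-> ->]]].
  have [r /= rE] := suf v; exists (l b ⋅ (l b)^-1), r.
  by rewrite /= rE mulVK// !mulA.
have [r rE] := suf v; exists (wval a' u), r.
by rewrite wval_cat /= rE !mulA.
Qed.

(** Words are nonempty, hence given by a first letter and the remaining ones. *)
Definition word (w : L * seq L) : A := wval w.1 w.2.

Lemma wordM v w : exists u, word v ⋅ word w = word u.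
Proof. by exists (v.1, v.2 ++ w.1 :: w.2); rewrite /word/= wval_cat. Qed.

(** The data that determine the R-class of a word: its first letter, and the
    set of pairs of consecutive letters. *)
Definition code (w : L * seq L) : L * {set L * L} :=
  (w.1, [set x | infix [:: x.1; x.2] (w.1 :: w.2)]%SET).

(** Induction on the prefixes of [v]: if [w] is a right multiple of a prefix
    ending in [a], and [a b] are consecutive letters of [v], then they are
    consecutive in [w] too, and [rle_strict] extends the prefix by [b]. *)
Lemma rle_code v w : code v = code w -> rle (word w) (word v).
Proof.
case: v w => [a s] [_ r] [<-] /setP sub; rewrite /word/=.
have {}sub b c : infix [:: b; c] (a :: s) -> infix [:: b; c] (a :: r).
  by have := sub (b, c); rewrite !inE/= => ->.
elim/last_ind: s sub => [|s c IH] sub; first exact: rle_wval_head.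
have [x xE] : rle (wval a r) (wval a s).
  by apply: IH => b d bd; apply: sub; rewrite -rcons_cons -cats1 infix_catr.
have [|q [t tE]] := wval_infix (sub (last a s) c _).
  apply/infixP; exists (belast a s), [::].
  by rewrite cats0 -rcons_cons lastI -!cats1 -catA.
rewrite wval_rcons xE -(wval_last a s).
by apply: (rle_strict SA (q := q) (r := t)); rewrite wval_last -xE tE.
Qed.

Lemma finite_right_words :
  finite_set (range (fun w => right_ideal1 (@Defs.mul A) (word w))).
Proof.
apply: (finite_image_factor (c := code)) => v w vw.
by apply: (rle_right_ideal SA); apply: rle_code.
Qed.

End Words.

Lemma wval_opp (A : algebra) (SA : SI A) (L : finType) (l : L -> A) a s :
  exists b r, wval l a s = @wval (opp A) L l b r.
Proof.
elim: s a => [|c s IH] a /=; first by exists a, [::].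
have [b [r ->]] := IH c; exists b, (rcons r a).
by rewrite wval_rcons//; exact: SI_opp.
Qed.

Lemma finite_left_words (A : algebra) (SA : SI A) (L : finType) (l : L -> A) :
  finite_set (range (fun w => left_ideal1 (@Defs.mul A) (word l w))).
Proof.
apply: sub_finite_set (finite_right_words (SI_opp SA) (l : L -> opp A)).
move=> _ [w _ <-]; have [b [r E]] := wval_opp SA l w.1 w.2.
by exists (b, r) => //=; rewrite /word -E.
Qed.

(** * Finitely generated algebras *)

Section FinitelyGenerated.

Variables (A : algebra) (SA : SI A) (L : finType) (l : L -> A).
Hypothesis lV : forall i, exists j, l j = (l i)^-1.
Hypothesis l_gen : forall P : set A, subalgebra P -> range l `<=` P -> P = setT.

Local Notation "⟦ w ⟧" := (word l w).

Lemma wordH_representatives : exists K : set (L * seq L), finite_set K /\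
  forall w, exists2 k, K k & greenH (@Defs.mul A) ⟦k⟧ ⟦w⟧.
Proof.
pose f w := (left_ideal1 (@Defs.mul A) ⟦w⟧, right_ideal1 (@Defs.mul A) ⟦w⟧).
have [|K [finK KP]] := @finite_representatives _ _ f.
  have fin := finite_setX (finite_left_words SA l) (finite_right_words SA l).
  apply: sub_finite_set fin.
  by move=> _ [w _ <-]; split; exists w.
by exists K; split => // w; have [k Kk [kL kR]] := KP w; exists k.
Qed.

(** The induction also carries [t'], because a word inner-equal to [(s t)'] is
    made from words inner-equal to [t'] and to [s']. *)
Lemma inner_word t : exists w, inner_eq t ⟦w⟧.
Proof.
pose P t := (exists w, inner_eq t ⟦w⟧) /\ (exists w, inner_eq t^-1 ⟦w⟧).
suff PT : P = setT by have [] : P t by rewrite PT.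
apply: l_gen => [|_ [i _ <-]].
  split=> [a b [[v av] [v' av']] [[w bw] [w' bw']]|a [av av']]; last first.
    by split=> //; rewrite invK.
  split.
    have [u E] := wordM SA l v w; exists u; rewrite -E; exact: inner_eq_mul.
  have [u E] := wordM SA l w' v'; exists u; rewrite -E => x y.
  by rewrite inv_mul_inner// -(inner_eq_mul SA bw' av') mulA.
split; first by exists (i, [::]).
by have [j jE] := lV i; exists (j, [::]); rewrite /word/= jE.
Qed.

(** The elements of these two forms are closed under inversion: by the fourth
    strict identity with [a = (d x)'], the inverse of [(d x)' y] is a right
    multiple of the inverse of [(d x) (d x)' y], which starts with [d]. *)
Lemma rle_letter_or_inv t : (exists i x, t = l i ⋅ x) \/
  (exists i x, rle t (l i ⋅ x)^-1).
Proof.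
pose P t := (exists i x, t = l i ⋅ x) \/ (exists i x, rle t (l i ⋅ x)^-1).
suff PT : P = setT by have : P t by rewrite PT.
apply: l_gen => [|_ [i _ <-]]; last first.
  by left; exists i, ((l i)^-1 ⋅ l i); rewrite mulA// mulVK.
split=> [a b [[i [x ->]]|[i [x [y ->]]]] _|a [[i [x ->]]|[i [x [y ->]]]]].
- by left; exists i, (x ⋅ b); rewrite mulA.
- by right; exists i, x, (y ⋅ b); rewrite mulA.
- by right; exists i, x; exact: rle_refl.
- right; exists i, (x ⋅ (l i ⋅ x)^-1 ⋅ y).
  by rewrite inv_mul// invK// !mulA//; exact: rle_mulr.
Qed.

(** Since [k' w = k' (k k' w)], and the inner factor [k'] may be replaced
    by a word, the R-class depends only on the code of a word starting with
    [k]. *)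
Lemma finite_right_inv_word k :
  finite_set (range (fun w => right_ideal1 (@Defs.mul A) (⟦k⟧^-1 ⋅ ⟦w⟧))).
Proof.
have [k' kk'] := inner_word ⟦k⟧^-1.
pose c w := k.2 ++ k'.1 :: k'.2 ++ w.1 :: w.2.
have cE w : ⟦(k.1, c w)⟧ = ⟦k⟧ ⋅ ⟦k'⟧ ⋅ ⟦w⟧.
  by rewrite /word/= !wval_cat// mulA.
have kE w : ⟦k⟧^-1 ⋅ ⟦w⟧ = ⟦k⟧^-1 ⋅ ⟦(k.1, c w)⟧.
  by rewrite cE -kk' !mulA// mulKV.
apply: (finite_image_factor (c := fun w => code (k.1, c w))) => v w vw.
apply: (rle_right_ideal SA); rewrite (kE v) (kE w).
  by apply: rle_mull => //; exact: (rle_code SA l).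
by apply: rle_mull => //; exact: (rle_code SA l).
Qed.

Lemma finite_right_classes : finite_set (range (right_ideal1 (@Defs.mul A))).
Proof.
have [K [finK KP]] := wordH_representatives.
pose R := right_ideal1 (@Defs.mul A).
apply: (@sub_finite_set _ _ (range (fun w => R ⟦w⟧) `|`
  \bigcup_(k in K) range (fun w => R (⟦k⟧^-1 ⋅ ⟦w⟧)))).
  have right_word x t : exists w, R (x ⋅ ⟦w⟧) = R (x ⋅ t).
    have [w tw] := inner_word t; exists w.
    by apply: rle_right_ideal => //; apply: rle_inner => //; exact: inner_eq_sym.
  move=> _ [t _ <-]; have [[i [x ->]]|[i [x tx]]] := rle_letter_or_inv t.
    by left; have [w wE] := right_word (l i) x; exists (i, w.1 :: w.2).
  right; have [w xw] := inner_word x.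
  have [k Kk [kL kR]] := KP (i, w.1 :: w.2).
  (* [l i ⋅ x] may be replaced by a word, and that word by its representative [k]. *)
  have wk : rle (⟦(i, w.1 :: w.2)⟧)^-1 ⟦k⟧^-1.
    apply: rle_inv_H => //; first exact: right_ideal_rle.
    exact: left_ideal_mul.
  have [y ->] : rle t ⟦k⟧^-1.
    apply: (rle_trans SA tx); apply: rle_trans wk => //.
    by apply: rle_inv_inner.
  by exists k => //; have [v vE] := right_word ⟦k⟧^-1 y; exists v.
rewrite finite_setU; split; first exact: finite_right_words.
by apply: bigcup_finite => // k _; exact: finite_right_inv_word.
Qed.

End FinitelyGenerated.

Lemma finite_right_fg (A : algebra) : SI A -> finitely_generated A ->
  finite_set (range (right_ideal1 (@Defs.mul A))).
Proof.
move=> SA [G [finG gen]].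
have /finite_seqP[s Gs] : finite_set (G : set {classic A}) by [].
pose l (x : seq_sub s * bool) : A := if x.2 then (ssval x.1)^-1 else ssval x.1.
apply: (@finite_right_classes A SA _ l) => [[x b]|P subP lP].
  by exists (x, ~~ b); case: b => //=; rewrite /l/= invK.
apply/seteqP; split=> // a _; suff : smallest (@subalgebra A) G `<=` P.
  by rewrite gen; apply.
apply: smallest_sub => // x; rewrite Gs /= => xs.
by apply: lP; exists (SeqSub xs, false).
Qed.

Lemma finitely_generated_opp (A : algebra) :
  finitely_generated A -> finitely_generated (opp A).
Proof.
move=> [G [finG gen]]; exists G; split => //.
apply/seteqP; split=> // a _ P [[PM PV] GP].
suff : smallest (@subalgebra A) G `<=` P by rewrite gen; apply.
by apply: smallest_sub => //; split => // x y Px Py; exact: PM.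
Qed.

Theorem corollary4p15 :
  locally_H_finite SI /\
  (forall V : set algebra, variety V -> V `<=` SI -> locally_H_finite V).
Proof.
suff SI_fin : locally_H_finite SI.
  by split=> // V _ VSI A VA; apply: SI_fin; exact: VSI.
move=> A SA fgA.
have finR := finite_right_fg SA fgA.
have finL := finite_right_fg (SI_opp SA) (finitely_generated_opp fgA).
apply: (@sub_finite_set _ _ ((fun IJ : set A * set A =>
    [set b | IJ.1 = left_ideal1 (@Defs.mul A) b /\
             IJ.2 = right_ideal1 (@Defs.mul A) b]) @`
    (range (left_ideal1 (@Defs.mul A)) `*` range (right_ideal1 (@Defs.mul A))))).
  move=> _ [a _ <-].
  exists (left_ideal1 (@Defs.mul A) a, right_ideal1 (@Defs.mul A) a); last by [].
  by split; exists a.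
by apply: finite_image; apply: finite_setX.
Qed.
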